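(* Let $m\in\{1,2,\ldots\}$ and let $\check\rho,\hat\rho>0$ with $\hat\rho=n\check\rho$ for some integer $n\ge 2$. Let $(\hat D_0,\hat D_1)\in\mathrm{bd}_{\hat\rho}$ and $(\check D_0,\check D_1)=\partial I(\hat D_0,\hat D_1)$. Then \[\check D_0=\bigcup_{\hat x\in\hat D_0}\ \bigcup_{\hat z\in\hat D_1\cap B_{\hat\rho}(\hat x)}\Big(B_{\hat\rho/2}(\hat x)\cap B_{(\hat\rho+\check\rho)/2}(\hat z)\cap\Delta_{\check\rho}\Big)\] and \[\check D_1=\bigcup_{\hat z\in\hat D_1}\ \bigcup_{\hat x\in\hat D_0\cap B_{\hat\rho}(\hat z)}\Big(B_{\hat\rho/2}(\hat z)\cap B_{\hat\rho/2+\check\rho}(\hat x)\cap\Big(\bigcap_{\hat x'\in\hat D_0\cap B_{\hat\rho}(\hat z)}B_{\hat\rho/2}(\hat x')^c\Big)\cap\Delta_{\check\rho}\Big).\]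
   Context: $\mathbb{R}^m$ carries the maximum norm $\|x\|_\infty=\max_{1\le j\le m}|x_j|$. For a point $x\in\mathbb{R}^m$ and nonempty $A\subset\mathbb{R}^m$, $\mathrm{d}(x,A)=\inf_{y\in A}\|x-y\|_\infty$, and $\mathrm{d}(x,\emptyset)=\infty$. For $A\subset\mathbb{R}^m$ and $\delta>0$, $B_\delta(A)=\{x\in\mathbb{R}^m:\mathrm{d}(x,A)\le\delta\}$, and $B_\delta(x)=B_\delta(\{x\})$ is the closed ball. The superscript $c$ denotes the complement in $\mathbb{R}^m$. For $\rho>0$: $\Delta_\rho=\rho\mathbb{Z}^m$, $S_\rho=\{M\subset\Delta_\rho:M\neq\emptyset\}$, $S_\rho^+=2^{\Delta_\rho}$. For $M\in S_\rho^+$: $\partial^0_\rho M=\{x\in M:\exists z\in M^c\cap\Delta_\rho,\ \|x-z\|_\infty=\rho\}$ and $\partial^1_\rho M=\{z\in M^c\cap\Delta_\rho:\mathrm{d}(z,\partial^0_\rho M)=\rho\}$. Paths: for $x,z\in\Delta_\rho$, $P_\rho(x,z)$ is the set of finite sequences $p=(\xi_0,\ldots,\xi_k)$ in $\Delta_\rho$, $k\in\{0,1,2,\ldots\}$, with $\xi_0=x$, $\xi_k=z$ and $\|\xi_\ell-\xi_{\ell-1}\|_\infty\le\rho$ for $\ell=1,\ldots,k$; $L(p)=k$, $p(\ell)=\xi_\ell$. $\mathrm{bd}_\rho^-\subset S_\rho^+\times S_\rho^+$ is the set of all pairs $(D_0,D_1)$ such that (1) $D_0\neq\emptyset\neq D_1$;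 (2) $D_0\cap D_1=\emptyset$; (3) for every $x\in D_0$ there is $z\in D_1$ with $\|x-z\|_\infty=\rho$; (4) for every $z\in D_1$ there is $x\in D_0$ with $\|x-z\|_\infty=\rho$; (5) for all $x\in D_0$, $z\in D_1$ and $p\in P_\rho(x,z)$ with $L(p)>1$ there is an integer $0<\ell<L(p)$ with $p(\ell)\in D_0\cup D_1$. Moreover $\mathrm{bd}_\rho=\mathrm{bd}_\rho^-\cup\{(\emptyset,\emptyset)\}$. $\mathrm{Tr}_\rho(M)=(\partial^0_\rho M,\partial^1_\rho M)$ for $M\in S_\rho$. It is a bijection $\mathrm{Tr}_\rho:S_\rho\to\mathrm{bd}_\rho$, whose inverse is given by $\mathrm{Tr}_\rho^{-1}(\emptyset,\emptyset)=\Delta_\rho$ and $\mathrm{Tr}_\rho^{-1}(D_0,D_1)=\{x\in\Delta_\rho:\mathrm{d}(x,D_0)<\mathrm{d}(x,D_1)\}$ for $(D_0,D_1)\in\mathrm{bd}_\rho^-$. Interpolation operator: $I:S_{\hat\rho}\to S_{\check\rho}$, $I(M)=B_{\hat\rho/2}(M)\cap\Delta_{\check\rho}$. Lifted interpolation operator: $\partial I:\mathrm{bd}_{\hat\rho}\to\mathrm{bd}_{\check\rho}$, $\partial I=\mathrm{Tr}_{\check\rho}\circ I\circ\mathrm{Tr}_{\hat\rho}^{-1}$. *)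

(* Defs.v *)
From mathcomp Require Export all_boot all_order all_algebra.
From mathcomp Require Export all_classical all_reals all_analysis.

Set Implicit Arguments.
Unset Strict Implicit.
Unset Printing Implicit Defensive.

Export Order.TTheory GRing.Theory Num.Theory.
Export numFieldNormedType.Exports.
#[global] Open Scope classical_set_scope.
#[global] Open Scope ring_scope.

Section Grids.
Context {R : realType} {m : nat}.
Implicit Types (x y z : 'rV[R]_m) (A M : set 'rV[R]_m) (rho delta : R)
  (p : seq 'rV[R]_m) (D : set 'rV[R]_m * set 'rV[R]_m).

(* The library norm on matrices is the maximum norm (mx_normrE), and the
   infimum of the empty set in \bar R is +oo, so that dist x set0 = +oo. *)
Definition dist x A : \bar R := ereal_inf [set `|x - y|%:E | y in A].

Definition nbhd delta A : set 'rV[R]_m := [set x | (dist x A <= delta%:E)%E].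

Definition cball delta x : set 'rV[R]_m := nbhd delta [set x].

Definition grid rho : set 'rV[R]_m :=
  [set x | exists k : 'rV[int]_m, x = rho *: map_mx intr k].

Definition bd0 rho M : set 'rV[R]_m :=
  [set x | M x /\ exists z, [/\ (~` M) z, grid rho z & `|x - z| = rho]].

Definition bd1 rho M : set 'rV[R]_m :=
  [set z | [/\ (~` M) z, grid rho z & dist z (bd0 rho M) = rho%:E]].

(* A path (xi_0, ..., xi_k) is the nonempty list of its k + 1 vertices;
   its length k counts the steps. *)
Definition grid_path rho x z : set (seq 'rV[R]_m) :=
  [set p | [/\ (0 < size p)%N,
    (forall l, (l < size p)%N -> grid rho (nth 0 p l)),
    nth 0 p 0 = x,
    nth 0 p (size p).-1 = z &
    forall l, (0 < l < size p)%N -> `|nth 0 p l - nth 0 p l.-1| <= rho]].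

Definition plength p : nat := (size p).-1.

Definition bd_pair_ne rho : set (set 'rV[R]_m * set 'rV[R]_m) :=
  [set D | (D.1 `<=` grid rho /\ D.2 `<=` grid rho) /\
    [/\ D.1 !=set0 /\ D.2 !=set0,
      D.1 `&` D.2 = set0,
      (forall x, D.1 x -> exists2 z, D.2 z & `|x - z| = rho),
      (forall z, D.2 z -> exists2 x, D.1 x & `|x - z| = rho) &
      forall x z p, D.1 x -> D.2 z -> grid_path rho x z p ->
        (1 < plength p)%N ->
        exists2 l, (0 < l < plength p)%N & (D.1 `|` D.2) (nth 0 p l)]].

Definition bd_pair rho : set (set 'rV[R]_m * set 'rV[R]_m) :=
  bd_pair_ne rho `|` [set (set0, set0)].

Definition trace rho M : set 'rV[R]_m * set 'rV[R]_m :=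
  (bd0 rho M, bd1 rho M).

(* The inverse of trace rho, as a map from bd_pair rho to the nonempty subsets
   of grid rho.  The pair (set0, set0) is the trace of the whole grid and needs
   its own case: the strict inequality below would read +oo < +oo. *)
Definition trace_inv rho D : set 'rV[R]_m :=
  if `[< D = (set0, set0) >] then grid rho
  else [set x | grid rho x /\ (dist x D.1 < dist x D.2)%E].

(* From the grid of mesh rho to the grid of mesh rho'. *)
Definition interp rho rho' M : set 'rV[R]_m :=
  nbhd (rho / 2) M `&` grid rho'.

Definition lifted_interp rho rho' D : set 'rV[R]_m * set 'rV[R]_m :=
  trace rho' (interp rho rho' (trace_inv rho D)).

End Grids.

(* Main.v *)
Require Import Defs.
From mathcomp Require Import zify ring lra.

Set Implicit Arguments.
Unset Strict Implicit.
Unset Printing Implicit Defensive.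

(** Write [Mh] for the coarse set whose trace is the given pair, and [M] for its
    interpolation to the fine grid: a fine point is in [M] when some point of
    [Mh] is within [rh / 2] of it.

    The heart of the matter is a separation property of boundary pairs
    ([bd_pair_adjacent]): if [x] in [Mh] and [z] outside [Mh] are adjacent
    coarse points, then [x] belongs to the inner layer and [z] to the outer one.
    Join a nearest inner point to [x] by a shortest path, step from [x] to [z],
    and go on by a shortest path to a nearest outer point.  As [x] is strictly
    closer to the inner layer and [z] is not, no interior vertex of this path
    can lie in either layer; the path axiom of boundary pairs then forces the
    path to be the single step from [x] to [z].

    The fine boundary is thereby located by the coarse one ([interp_crossing]).
    Let [x] in [M] and [z] outside [M] be adjacent fine points.  A point [xh]
    of [Mh] within [rh / 2] of [x], and a coarse point [zh] nearest to [z],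
    which is outside [Mh], satisfy [|xh - zh| < 2 rh]; being coarse points they
    are adjacent, so the separation property applies to them.  The sharp bound
    [(rh + rc) / 2] on [|x - zh|] needs some care when [n] is even, since a
    coordinate of [z] may then be the midpoint of two coarse ones; rounding it
    towards [x] repairs this ([grid_round]).

    For the reverse inclusions one produces the missing fine neighbour by moving
    one fine step, in all coordinates at once, towards a coarse point
    ([grid_step]): towards [zh] one gets so close that [zh] is the only coarse
    point within [rh / 2], hence leaves [M]; towards [xh] one gets within
    [rh / 2] of [xh], hence enters [M].

    The pair of empty sets is separate: it encodes the whole grid, whose
    interpolation is the whole fine grid, without boundary. *)

(** * Maximum norm and grids *)

Section GridGeometry.
Context {R : realType} {m : nat}.
Implicit Types (x y z : 'rV[R]_m) (A : set 'rV[R]_m) (rho r : R).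

Lemma row_norm_leP x r :
  0 <= r -> reflect (forall i, `|x 0 i| <= r) (`|x| <= r).
Proof.
move=> r_ge0; rewrite [`|x|]mx_normrE.
apply: (iffP (@bigmax_leP _ _ _ _ _ _ _)) => [[_ le_r] i|le_r].
  exact: (le_r (0, i)).
by split=> // -[i j] _ /=; rewrite ord1.
Qed.

Lemma grid_coord_norm rho (a b : int) : 0 < rho ->
  `|rho * a%:~R - rho * b%:~R| = rho * `|a - b|%:~R.
Proof.
by move=> rho_gt0; rewrite -mulrBr -intrB normrM (gtr0_norm rho_gt0) intr_norm.
Qed.

Lemma grid_norm rho x y : 0 < rho -> grid rho x -> grid rho y ->
  exists N : nat, `|x - y| = rho * N%:R.
Proof.
move=> rho_gt0 [k ->] [l ->].
set u := rho *: map_mx _ k; set v := rho *: map_mx _ l.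
have [->|nz] := eqVneq `|u - v| 0.
  by exists 0%N; rewrite mulr0.
have [[i j] /= E] := mx_norm_neq0 nz.
exists (absz (k i j - l i j)).
by rewrite [LHS]E !mxE grid_coord_norm // -abszE.
Qed.

Lemma grid_norm_lt rho x y (N : nat) : 0 < rho -> grid rho x -> grid rho y ->
  `|x - y| < rho * N.+1%:R -> `|x - y| <= rho * N%:R.
Proof.
move=> rho_gt0 gx gy; have [K ->] := grid_norm rho_gt0 gx gy.
by rewrite ltr_pM2l // ler_pM2l // ltr_nat ler_nat ltnS.
Qed.

Lemma grid_eq rho x y : 0 < rho -> grid rho x -> grid rho y ->
  `|x - y| < rho -> x = y.
Proof.
move=> rho_gt0 gx gy lt_rho.
have := @grid_norm_lt rho x y 0 rho_gt0 gx gy.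
by rewrite mulr1 mulr0 normr_le0 subr_eq0 => /(_ lt_rho)/eqP.
Qed.

Lemma sub_grid rho (n : nat) : grid (n%:R * rho) `<=` @grid R m rho.
Proof.
move=> x [k ->]; exists (k *+ n).
apply/rowP => i; rewrite !mxE mulmxnE rmorphMn /=.
by rewrite mulrnAr -[RHS]mulr_natl mulrA.
Qed.

(** [k'] is at distance at most [max 0 (|k - l| - 1)] from [l]; the disjunction
    spares the maximum. *)
Lemma int_step (k l : int) : exists k' : int,
  `|k - k'| <= 1 /\ (k' = l \/ `|k' - l| + 1 <= `|k - l|).
Proof.
have [lt_kl|lt_lk|->] := ltgtP k l.
- by exists (k + 1); lia.
- by exists (k - 1); lia.
- by exists l; lia.
Qed.

(** Moving every coordinate in which [x] and [y] differ by one mesh towards [y]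
    shortens the maximum distance to [y] by one mesh, unless [x = y].  The last clause is the form of
    [|x' - y| <= max 0 (|x - y| - rho)] that also serves when [x - y] is only
    bounded by a non-multiple of [rho]. *)
Lemma grid_step rho x y : 0 < rho -> grid rho x -> grid rho y ->
  exists x', [/\ grid rho x', `|x - x'| <= rho &
    forall r, 0 <= r -> `|x - y| <= r + rho -> `|x' - y| <= r].
Proof.
move=> rho_gt0 [k ->] [l ->].
have [f fP] := fin_all_exists (fun i : 'I_m => int_step (k 0 i) (l 0 i)).
exists (rho *: map_mx intr (\row_i f i)); split.
- by exists (\row_i f i).
- apply/row_norm_leP => [|i]; first exact: ltW.
  rewrite !mxE grid_coord_norm // -[leRHS]mulr1 ler_pM2l //.
  by have [+ _] := fP i; rewrite -(ler_int R).
- move=> r r_ge0 /row_norm_leP le_r; apply/row_norm_leP => // i.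
  have {le_r} := le_r (addr_ge0 r_ge0 (ltW rho_gt0)) i.
  rewrite !mxE !grid_coord_norm //; have [_ [->|]] := fP i.
    by rewrite subrr normr0 mulr0.
  rewrite -(ler_int R) -(ler_pM2l rho_gt0) intrD mulrDr mulr1 => le1 le2.
  by rewrite -(lerD2r rho); apply: le_trans le2.
Qed.

(** A shortest path from [x] to [y].  Only the values of [f] up to [N] matter;
    a total [f] keeps the bounds free of side conditions. *)
Lemma grid_geodesic rho x y (N : nat) : 0 < rho -> grid rho x -> grid rho y ->
  `|x - y| = rho * N%:R ->
  exists f : nat -> 'rV[R]_m, [/\ f 0 = x, f N = y,
    forall j, grid rho (f j), forall j, `|f j - f j.+1| <= rho &
    forall j, `|x - f j| <= rho * j%:R].
Proof.
move=> rho_gt0 gx gy.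
elim: N x gx => [|N IHN] x gx.
  rewrite mulr0 => /eqP; rewrite normr_eq0 subr_eq0 => /eqP <-.
  exists (fun=> x); split=> // j; rewrite subrr normr0; first exact: ltW.
  by rewrite mulr_ge0 // ltW.
move=> dxy; have [x' [gx' dxx' near]] := grid_step rho_gt0 gx gy.
have dx'y : `|x' - y| = rho * N%:R.
  apply/le_anti/andP; split.
    by apply: near; [rewrite mulr_ge0 // ltW | rewrite dxy -natr1 mulrDr mulr1].
  have := ler_distD x' x y; rewrite dxy -natr1 mulrDr mulr1; lra.
have [f [f0 fN gf fS df]] := IHN _ gx' dx'y.
exists (fun j => if j is j'.+1 then f j' else x); split=> //.
- by case.
- by case=> [|j] //; rewrite f0.
case=> [|j]; first by rewrite subrr normr0 mulr0.
by rewrite -natr1 mulrDr mulr1; have := ler_distD x' x (f j); have := df j; lra.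
Qed.

(** One coordinate of [grid_round], in units of the fine mesh. *)
Lemma int_round (n : nat) (k l : int) : (2 <= n)%N -> `|k - l| <= 1 ->
  exists a : int,
    `|l - a * n%:Z| *+ 2 <= n%:Z /\ `|k - a * n%:Z| *+ 2 <= n%:Z + 1.
Proof.
move=> n_ge2 le_kl.
have r_ge0 : 0 <= (l %% n%:Z)%Z by apply: modz_ge0; lia.
have r_lt : (l %% n%:Z)%Z < n%:Z by apply: ltz_pmod; lia.
have lE := divz_eq l n%:Z.
set q := (l %/ n%:Z)%Z in lE; set r := (l %% n%:Z)%Z in lE r_ge0 r_lt.
have [low|high] : (r *+ 2 < n%:Z \/ r *+ 2 = n%:Z /\ k <= l) \/
    (n%:Z < r *+ 2 \/ r *+ 2 = n%:Z /\ l < k) by lia.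
- by exists q; move: (q * n%:Z) lE => qn lE; lia.
- by exists (q + 1); rewrite mulrDl mul1r; move: (q * n%:Z) lE => qn lE; lia.
Qed.

(** Each coordinate of [z] is rounded to a nearest point of the coarse grid, a
    tie being resolved towards [x].  If the coordinate is not a midpoint, its
    rounding error is at most [(n - 1) / 2] fine meshes, and the step to [x]
    adds at most one; at a midpoint, the step to [x] does not increase the
    error [n / 2]. *)
Lemma grid_round rho (n : nat) x z : 0 < rho -> (2 <= n)%N ->
  grid rho x -> grid rho z -> `|x - z| <= rho ->
  exists2 zh, grid (n%:R * rho) zh &
    `|z - zh| <= n%:R * rho / 2 /\ `|x - zh| <= (n%:R * rho + rho) / 2.
Proof.
move=> rho_gt0 n_ge2 [k ->] [l ->] /row_norm_leP le_xz.
have n_gt0 : 0 < n%:R :> R by rewrite ltr0n; lia.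
have nrho_gt0 : 0 < n%:R * rho by rewrite mulr_gt0.
have le_kl i : `|k 0 i - l 0 i| <= 1.
  have := le_xz (ltW rho_gt0) i.
  by rewrite !mxE grid_coord_norm // -[leRHS]mulr1 ler_pM2l // -(ler_int R).
have [a aP] := fin_all_exists (fun i : 'I_m => int_round n_ge2 (le_kl i)).
have aE i : (n%:R * rho) * (a i)%:~R = rho * (a i * n%:Z)%:~R :> R.
  by rewrite intrM; ring.
exists ((n%:R * rho) *: map_mx intr (\row_i a i)); first by exists (\row_i a i).
split; apply/row_norm_leP => [|i]; try lra;
  rewrite !mxE aE grid_coord_norm // ler_pdivlMr // -mulrA.
- have [+ _] := aP i; rewrite -(ler_int R) -(ler_pM2l rho_gt0).
  by rewrite rmorphMn /= -pmulrn; lra.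
- have [_ +] := aP i; rewrite -(ler_int R) -(ler_pM2l rho_gt0).
  by rewrite rmorphMn /= intrD -pmulrn; lra.
Qed.

(** * Distances within a grid are attained *)

(** Distances between grid points are integer multiples of the mesh, so the
    infimum is a minimum. *)
Lemma dist_attained rho x A : 0 < rho -> grid rho x -> A `<=` grid rho ->
  A !=set0 -> exists2 y, A y & dist x A = `|x - y|%:E.
Proof.
move=> rho_gt0 gx gA [y0 Ay0].
have [|N [[y Ay dxy] minN]] :=
    nat_has_minimum (A := [set N | exists2 y, A y & `|x - y| = rho * N%:R]).
  by have [N dN] := grid_norm rho_gt0 gx (gA _ Ay0); exists N; exists y0.
exists y => //; apply/le_anti/andP; split.
  by apply: ereal_inf_lbound; exists y.
apply: le_ereal_inf_tmp => _ [y' Ay' <-]; rewrite lee_fin dxy.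
have [N' dN'] := grid_norm rho_gt0 gx (gA _ Ay').
by rewrite dN' ler_pM2l // ler_nat; apply: minN; exists y'.
Qed.

Lemma dist_le x y A : A y -> (dist x A <= `|x - y|%:E)%E.
Proof. by move=> Ay; apply: ereal_inf_lbound; exists y. Qed.

Lemma dist_set0 x : dist x set0 = +oo%E.
Proof. by rewrite /dist image_set0 ereal_inf0. Qed.

Lemma nbhd_gridP rho r x A : 0 < rho -> grid rho x -> A `<=` grid rho ->
  nbhd r A x <-> exists2 y, A y & `|x - y| <= r.
Proof.
move=> rho_gt0 gx gA; split=> [|[y Ay le_r]]; last first.
  by apply: le_trans (dist_le x Ay) _; rewrite lee_fin.
have [->|/set0P A_neq0] := eqVneq A set0.
  by rewrite /nbhd /= dist_set0 leye_eq.
have [y Ay dxy] := dist_attained rho_gt0 gx gA A_neq0.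
by rewrite /nbhd /= dxy lee_fin; exists y.
Qed.

Lemma cballE r x y : cball r x y = (`|y - x| <= r) :> Prop.
Proof. by rewrite /cball /nbhd /= /dist image_set1 ereal_inf1 lee_fin. Qed.

End GridGeometry.

(** * Boundary layers and separation *)

Section Boundary.
Context {R : realType} {m : nat}.
Implicit Types (x y z : 'rV[R]_m) (M : set 'rV[R]_m) (rho : R)
  (D : set 'rV[R]_m * set 'rV[R]_m).

(** Being at distance [rho] from the inner boundary may be replaced by having a
    neighbour in [M]: that neighbour is an inner boundary point, with [z] as its
    witness.  This makes the two layers symmetric. *)
Lemma bd1P rho M z : 0 < rho -> M `<=` grid rho ->
  bd1 rho M z <-> [/\ ~ M z, grid rho z & exists2 x, M x & `|x - z| = rho].
Proof.
move=> rho_gt0 gM.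
have gbd0 : bd0 rho M `<=` grid rho by move=> y [/gM].
split=> [[nMz gz dz]|[nMz gz [x Mx dxz]]].
  split=> //; have [bd0_eq0|/set0P bd0_neq0] := eqVneq (bd0 rho M) set0.
    by move: dz; rewrite bd0_eq0 dist_set0.
  have [x [Mx _] dzx] := dist_attained rho_gt0 gz gbd0 bd0_neq0.
  by exists x => //; move: dz; rewrite dzx distrC => -[].
have bd0x : bd0 rho M x by split=> //; exists z.
split=> //; apply/le_anti/andP; split.
  by apply: le_trans (dist_le z bd0x) _; rewrite distrC dxz.
apply: le_ereal_inf_tmp => _ [y [My _] <-]; rewrite lee_fin leNgt.
by apply/negP => /(grid_eq rho_gt0 gz (gM _ My)) zy; apply: nMz; rewrite zy.
Qed.

Lemma trace_inv_neE rho D y : bd_pair_ne rho D ->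
  trace_inv rho D y <-> grid rho y /\ (dist y D.1 < dist y D.2)%E.
Proof.
case=> _ [[[x Dx] _] _ _ _ _]; rewrite /trace_inv; case: asboolP => // D0.
by rewrite D0 in Dx.
Qed.

Lemma trace_inv_inner rho D : 0 < rho -> bd_pair_ne rho D ->
  D.1 `<=` trace_inv rho D.
Proof.
move=> rho_gt0 bdD x D1x; apply/(trace_inv_neE _ bdD).
have [[gD1 gD2] [[_ D2_neq0] D12 _ _ _]] := bdD.
have gx := gD1 _ D1x; split=> //.
have [z D2z ->] := dist_attained rho_gt0 gx gD2 D2_neq0.
apply: le_lt_trans (dist_le x D1x) _.
rewrite subrr normr0 lte_fin normr_gt0 subr_eq0; apply/eqP => xz.
by have : (D.1 `&` D.2) x by [split; rewrite // xz]; rewrite D12.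
Qed.

Lemma trace_inv_outer rho D z :
  bd_pair_ne rho D -> D.2 z -> ~ trace_inv rho D z.
Proof.
move=> bdD D2z /(trace_inv_neE _ bdD)[_].
apply/negP; rewrite -leNgt; apply: le_trans (dist_le z D2z) _.
rewrite subrr normr0; apply: le_ereal_inf_tmp => _ [y _ <-].
by rewrite lee_fin.
Qed.

(** This is where the path axiom of boundary pairs is used. *)
Lemma bd_pair_adjacent rho D x z : 0 < rho -> bd_pair_ne rho D ->
  trace_inv rho D x -> grid rho z -> ~ trace_inv rho D z ->
  `|x - z| <= rho -> D.1 x /\ D.2 z.
Proof.
move=> rho_gt0 bdD /(trace_inv_neE _ bdD)[gx lt_x] gz nMz dxz.
have {nMz} le_z : (dist z D.2 <= dist z D.1)%E.
  by rewrite leNgt; apply/negP => lt_z; apply/nMz/(trace_inv_neE _ bdD).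
have [[gD1 gD2] [[D1_neq0 D2_neq0] _ _ _ sepD]] := bdD.
have [x0 D1x0 dx] := dist_attained rho_gt0 gx gD1 D1_neq0.
have [z0 D2z0 dz] := dist_attained rho_gt0 gz gD2 D2_neq0.
have [N dN] := grid_norm rho_gt0 gx (gD1 _ D1x0).
have [K dK] := grid_norm rho_gt0 gz (gD2 _ D2z0).
have [f [f0 fN gf fS df]] := grid_geodesic rho_gt0 gx (gD1 _ D1x0) dN.
have [g [g0 gK gg gS dg]] := grid_geodesic rho_gt0 gz (gD2 _ D2z0) dK.
(* Vertices strictly between [x] and [x0], or [x] itself if [N > 0], are too
   close to [x] to be in a layer. *)
have D'f j : (j < N)%N -> ~ (D.1 `|` D.2) (f j).
  move=> lt_jN Dfj; have : (dist x D.1 <= `|x - f j|%:E)%E.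
    case: Dfj => [/dist_le//|/dist_le le_f]; apply: le_trans (le_f x).
    exact: ltW.
  rewrite dx dN lee_fin leNgt => /negP; apply.
  by apply: le_lt_trans (df j) _; rewrite ltr_pM2l // ltr_nat.
have D'g j : (j < K)%N -> ~ (D.1 `|` D.2) (g j).
  move=> lt_jK Dgj; have : (dist z D.2 <= `|z - g j|%:E)%E.
    case: Dgj => [/dist_le le_g|/dist_le//].
    exact: le_trans le_z (le_g z).
  rewrite dz dK lee_fin leNgt => /negP; apply.
  by apply: le_lt_trans (dg j) _; rewrite ltr_pM2l // ltr_nat.
have [/eqP|NK_gt0] := posnP (N + K).
  rewrite addn_eq0 => /andP[/eqP N0 /eqP K0].
  by move: fN gK; rewrite N0 K0 f0 g0 => -> ->.
exfalso.
(* The path runs backwards along [f] from [x0] to [x], then along [g] from [z]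
   to [z0]; [x] has index [N] and [z] has index [N + 1]. *)
pose v l := if (l <= N)%N then f (N - l)%N else g (l - N.+1)%N.
pose p := mkseq v (N + K).+2.
have [||l /andP[l_gt0 lt_l] Dl] := sepD x0 z0 p D1x0 D2z0.
- split; rewrite ?size_mkseq //.
  + by move=> l lt_l; rewrite nth_mkseq // /v; case: ifP.
  + by rewrite nth_mkseq // /v subn0.
  + rewrite nth_mkseq //= /v ltnNge leq_addr /=.
    by rewrite subSS addKn.
  + move=> [|l] // lt_l; rewrite !nth_mkseq //=; last exact: ltnW.
    rewrite /v; have [lt_lN|lt_Nl|lN] := ltngtP l N.
    * by rewrite -(subnSK lt_lN).
    * by rewrite subSS -(subnSK lt_Nl) distrC.
    * by rewrite lN subSS subnn f0 g0 distrC.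
- by rewrite /plength size_mkseq /= ltnS.
move: lt_l; rewrite /plength size_mkseq /= => lt_l.
move: Dl; rewrite nth_mkseq; last exact: ltnW.
rewrite /v; case: leqP => [le_lN|lt_Nl]; first by apply: D'f; lia.
by apply: D'g; lia.
Qed.

End Boundary.

(** * Interpolation *)

Section Interpolation.
Context {R : realType} {m : nat}.
Variables (n : nat) (rc rh : R) (Dh0 Dh1 : set 'rV[R]_m).
Hypotheses (n_ge2 : (2 <= n)%N) (rc_gt0 : 0 < rc) (rh_gt0 : 0 < rh)
  (rhE : rh = n%:R * rc) (bdD : bd_pair_ne rh (Dh0, Dh1)).

Let Mh := trace_inv rh (Dh0, Dh1).
Let M := interp rh rc Mh.

Let mesh_bounds : 0 < rc /\ rc + rc <= rh.
Proof.
split=> //; rewrite rhE -mulr2n -[leLHS]mulr_natl.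
by rewrite ler_wpM2r ?ler_nat // ltW.
Qed.

Let gMh : Mh `<=` grid rh.
Proof. by move=> x /(trace_inv_neE _ bdD)[]. Qed.

Let gh_gc : grid rh `<=` @grid R m rc.
Proof. by rewrite rhE; apply: sub_grid. Qed.

Lemma interpP y : grid rc y ->
  M y <-> exists2 xh, Mh xh & `|y - xh| <= rh / 2.
Proof.
move=> gy; have := nbhd_gridP (rh / 2) rc_gt0 gy (subset_trans gMh gh_gc).
by move=> <-; split=> [[]|].
Qed.

(** A fine edge that leaves [M] lies close to a coarse edge between the two
    given layers. *)
Lemma interp_crossing x z : M x -> grid rc z -> ~ M z -> `|x - z| = rc ->
  exists xh zh, [/\ Dh0 xh, Dh1 zh, `|xh - zh| <= rh &
    [/\ `|x - xh| <= rh / 2, `|z - zh| <= rh / 2 & `|x - zh| <= (rh + rc) / 2]].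
Proof.
have [rc_pos mesh_le] := mesh_bounds.
move=> Mx gz nMz dxz; have [_ gx] := Mx.
have [xh Mxh dxxh] := (interpP gx).1 Mx.
have dxz_le : `|x - z| <= rc by rewrite dxz.
have [zh] := grid_round rc_gt0 n_ge2 gx gz dxz_le.
rewrite -rhE => gzh [dzzh dxzh].
have nMzh : ~ Mh zh by move=> Mzh; apply/nMz/(interpP gz); exists zh.
have dxzhh : `|xh - zh| <= rh.
  have := grid_norm_lt (N := 1) rh_gt0 (gMh Mxh) gzh.
  rewrite !mulr_natr mulr2n mulr1n; apply.
  by have := ler_distD x xh zh; rewrite (distrC xh x); lra.
have [Dxh Dzh] := bd_pair_adjacent rh_gt0 bdD Mxh gzh nMzh dxzhh.
by exists xh, zh.
Qed.

Lemma bd0_interp : bd0 rc M =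
  \bigcup_(xh in Dh0) \bigcup_(zh in Dh1 `&` cball rh xh)
    (cball (rh / 2) xh `&` cball ((rh + rc) / 2) zh `&` grid rc).
Proof.
have [rc_pos mesh_le] := mesh_bounds.
apply/seteqP; split=> x.
  move=> [Mx [z [nMz gz dxz]]].
  have [xh [zh [Dxh Dzh dxzh [dx dz dxz']]]] := interp_crossing Mx gz nMz dxz.
  exists xh => //; exists zh; first by split; rewrite // cballE distrC.
  by have [_ gx] := Mx; split=> //; split; rewrite cballE.
move=> [xh Dxh [zh [Dzh]]]; rewrite cballE distrC => dxzh [[]].
rewrite !cballE => dx dzh gx.
have gzh : grid rh zh by have [[_ +] _] := bdD; apply.
have Mxh : Mh xh by exact: (trace_inv_inner rh_gt0 bdD).
have nMzh : ~ Mh zh by exact: (trace_inv_outer bdD).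
have Mx : M x by apply/(interpP gx); exists xh.
split=> //.
have [z [gz dxz near]] := grid_step rc_gt0 gx (gh_gc gzh).
have dz : `|z - zh| <= (rh - rc) / 2.
  by apply: near; lra.
have nMz : ~ M z.
  move=> /(interpP gz)[yh Myh dzy]; apply: nMzh.
  (* [z] is less than [rh / 2] away from [zh], so every other coarse point is
     more than [rh / 2] away. *)
  suff -> : zh = yh by [].
  apply: (grid_eq rh_gt0 gzh (gMh Myh)).
  by have := ler_distD z zh yh; rewrite (distrC zh z); lra.
exists z; split=> //; apply/le_anti; rewrite dxz /= leNgt; apply/negP => lt_rc.
by apply: nMz; rewrite -(grid_eq rc_gt0 gx gz lt_rc).
Qed.

Lemma bd1_interp : bd1 rc M =
  \bigcup_(zh in Dh1) \bigcup_(xh in Dh0 `&` cball rh zh)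
    (cball (rh / 2) zh `&` cball (rh / 2 + rc) xh
     `&` (\bigcap_(xh' in Dh0 `&` cball rh zh) ~` cball (rh / 2) xh')
     `&` grid rc).
Proof.
have [rc_pos mesh_le] := mesh_bounds.
have gM : M `<=` grid rc by move=> x [].
apply/seteqP; split=> z.
  move=> /(bd1P _ rc_gt0 gM)[nMz gz [x Mx dxz]].
  have [xh [zh [Dxh Dzh dxzh [dx dz _]]]] := interp_crossing Mx gz nMz dxz.
  exists zh => //; exists xh; first by split; rewrite // cballE.
  split=> //; split; first split.
  - by rewrite cballE.
  - by rewrite cballE; have := ler_distD x z xh; rewrite (distrC z x); lra.
  - move=> yh [Dyh _]; rewrite /setC /= cballE => dyz.
    apply/nMz/(interpP gz); exists yh => //.
    exact: (trace_inv_inner rh_gt0 bdD).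
move=> [zh Dzh [xh [Dxh _]]] [[[]]]; rewrite !cballE => dzh dxh far gz.
have gzh : grid rh zh by have [[_ +] _] := bdD; apply.
have gxh : grid rh xh by have [[+ _] _] := bdD; apply.
have nMzh : ~ Mh zh by exact: (trace_inv_outer bdD).
have Mxh : Mh xh by exact: (trace_inv_inner rh_gt0 bdD).
have nMz : ~ M z.
  move=> /(interpP gz)[yh Myh dzy].
  have dyzh : `|yh - zh| <= rh.
    by have := ler_distD z yh zh; rewrite (distrC yh z); lra.
  have [Dyh _] := bd_pair_adjacent rh_gt0 bdD Myh gzh nMzh dyzh.
  by apply: (far yh); [split; rewrite // cballE | rewrite cballE].
have [x [gx dzx near]] := grid_step rc_gt0 gz (gh_gc gxh).
have Mx : M x.
  apply/(interpP gx); exists xh => //.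
  by apply: near; lra.
apply/(bd1P _ rc_gt0 gM); split=> //; exists x => //.
apply/le_anti; rewrite distrC dzx /= leNgt; apply/negP => lt_rc.
by apply: nMz; rewrite (grid_eq rc_gt0 gz gx lt_rc).
Qed.

End Interpolation.

Lemma interp_grid {R : realType} {m : nat} (n : nat) (rc rh : R) :
  0 < rc -> (2 <= n)%N -> rh = n%:R * rc ->
  interp rh rc (grid rh) = @grid R m rc.
Proof.
move=> rc_gt0 n_ge2 rhE; apply/seteqP; split=> x; first by case.
move=> gx; split=> //.
have dxx : `|x - x| <= rc by rewrite subrr normr0 ltW.
have [xh gxh [dx _]] := grid_round rc_gt0 n_ge2 gx gx dxx.
have sub : grid rh `<=` @grid R m rc by rewrite rhE; apply: sub_grid.
by apply/(nbhd_gridP _ rc_gt0 gx sub); rewrite rhE; exists xh.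
Qed.

Lemma trace_grid {R : realType} {m : nat} (rho : R) :
  0 < rho -> trace rho (@grid R m rho) = (set0, set0).
Proof.
move=> rho_gt0; congr pair; apply/seteqP; split=> // x.
- by case=> _ [z [nz gz]].
- by case.
Qed.

Theorem theorem29 (R : realType) (m n : nat) (rc rh : R)
    (Dh0 Dh1 Dc0 Dc1 : set 'rV[R]_m) :
  (1 <= m)%N -> 0 < rc -> 0 < rh -> (2 <= n)%N -> rh = n%:R * rc ->
  bd_pair rh (Dh0, Dh1) ->
  (Dc0, Dc1) = lifted_interp rh rc (Dh0, Dh1) ->
  Dc0 = \bigcup_(xh in Dh0) \bigcup_(zh in Dh1 `&` cball rh xh)
          (cball (rh / 2) xh `&` cball ((rh + rc) / 2) zh `&` grid rc)
  /\
  Dc1 = \bigcup_(zh in Dh1) \bigcup_(xh in Dh0 `&` cball rh zh)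
          (cball (rh / 2) zh `&` cball (rh / 2 + rc) xh
           `&` (\bigcap_(xh' in Dh0 `&` cball rh zh) ~` cball (rh / 2) xh')
           `&` grid rc).
Proof.
move=> _ rc_gt0 rh_gt0 n_ge2 rhE [bdD|[-> ->]].
  move=> [-> ->]; split.
  - exact: bd0_interp n_ge2 rc_gt0 rh_gt0 rhE bdD.
  - exact: bd1_interp n_ge2 rc_gt0 rh_gt0 rhE bdD.
rewrite /lifted_interp /trace_inv; case: asboolP => // _.
rewrite (interp_grid rc_gt0 n_ge2 rhE) trace_grid // => -[-> ->].
by rewrite !bigcup_set0.
Qed.
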